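(* Let $m,n$ be positive integers and let $c\ge 0$, $d\ge 1$ be integers with $\gcd(c,d)=1$ and $0<\lfloor \frac{n}{d}\rfloor\le\lfloor\frac{m}{c}\rfloor$. Let $\bar n\in\{0,1,\dots,d-1\}$ be the remainder of $n$ modulo $d$. For the one-move rider $\mathbb{P}$ with move set $\mathbf{M}=\{(c,d)\}$ on the $m\times n$ rectangular board and any integer $q\ge 1$, the number $u_{\mathbb{P}}(q;m,n)$ of nonattacking configurations of $q$ unlabelled pieces equals $$\sum_{k+j+x_1+\dots+x_{2cd}=q}\binom{(d-\bar n)\left(m-c\lfloor\tfrac{n}{d}\rfloor\right)+c(\bar n+d)}{j}\left\lfloor\tfrac{n}{d}\right\rfloor^{j}\binom{\bar n\left(m-c\lfloor\tfrac{n}{d}\rfloor\right)}{k}\left(\left\lfloor\tfrac{n}{d}\right\rfloor+1\right)^{k}\prod_{i=1}^{2cd}\left[{\lfloor\tfrac{n}{d}\rfloor\atop \lfloor\tfrac{n}{d}\rfloor-x_i}\right],$$ where the sum is over all tuples $(k,j,x_1,\dots,x_{2cd})$ of nonnegative integers with $k+j+x_1+\dots+x_{2cd}=q$, and the square brackets denote unsigned Stirling numbers of the first kind.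
   Context: The $m\times n$ board is $\{1,\dots,m\}\times\{1,\dots,n\}\subset\mathbb{Z}^2$. A one-move rider with move set $\mathbf{M}=\{(c,d)\}$ is a piece that, from a lattice point $z\in\mathbb{Z}^2$, attacks every lattice point $z+k(c,d)$ with $k\in\mathbb{Z}$, $k\neq 0$. A nonattacking configuration of $q$ pieces is a $q$-element subset of the board in which no point is attacked by a piece placed at another point of the subset; $u_{\mathbb{P}}(q;m,n)$ is the number of such subsets. The unsigned Stirling number of the first kind $\left[{N\atop r}\right]$ is the number of permutations of $N$ elements with exactly $r$ cycles, equivalently $x(x+1)\cdots(x+N-1)=\sum_{r}\left[{N\atop r}\right]x^r$; it is $0$ when $r<0$ or $r>N$. Binomial coefficients $\binom{a}{b}$ with integers $a,b\ge 0$ are $0$ when $b>a$. When $c=0$ (so $d=1$), $\lfloor m/c\rfloor$ is read as $+\infty$, so the inequality $\lfloor n/d\rfloor\le\lfloor m/c\rfloor$ holds automatically, and the product over $i$ is empty (equal to $1$). *)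

(* Defs.v *)
From HB Require Import structures.
From mathcomp Require Import all_boot all_order all_fingroup all_algebra.
From mathcomp Require Import boolp.

Set Implicit Arguments.
Unset Strict Implicit.
Unset Printing Implicit Defensive.

Import GRing.Theory.

(* The square indexed by (i, j) : 'I_m * 'I_n is the lattice point
   (i + 1, j + 1), so that the board is {1..m} x {1..n}. *)
Definition square (m n : nat) (s : 'I_m * 'I_n) : int * int :=
  (Posz s.1.+1, Posz s.2.+1).

Definition attacks (M z w : int * int) : Prop :=
  exists k : int, k <> 0%R /\ w = (z.1 + k * M.1, z.2 + k * M.2)%R.

Definition nonattacking (M : int * int) (m n : nat)
    (S : {set 'I_m * 'I_n}) : Prop :=
  forall s t, s \in S -> t \in S -> s <> t -> ~ attacks M (square s) (square t).

Definition rider_count (M : int * int) (q m n : nat) : nat :=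
  #|[set S : {set 'I_m * 'I_n} | (#|S| == q) && `[< nonattacking M S >]]|.

(* The lower argument is an integer, so that the number is 0 when r < 0.
   Fixed points count as cycles: [porbits s] contains singleton orbits. *)
Definition stirling1 (N : nat) (r : int) : nat :=
  #|[set s : 'S_N | Posz #|porbits s| == r]|.

(* Main.v *)
(* A nonattacking configuration chooses at most one point on each maximal line
   of direction (c, d) of the board, so its generating function is the product
   over lines of (1 + length * X).  The number of lines of length l is the second
   difference of (m - l c)(n - l d), which gives 2cd lines of each length
   l < N = n %/ d and the two exceptional counts for l = N and l = N + 1, beyond
   which there are none.  Finally (1 + X)(1 + 2X)...(1 + (N - 1)X) is the
   generating function of the Stirling numbers [N, N - x]. *)
Require Import Defs.
From HB Require Import structures.
From mathcomp Require Import all_boot all_order all_fingroup all_algebra.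
From mathcomp Require Import boolp.
From mathcomp Require Import zify.

Set Implicit Arguments.
Unset Strict Implicit.
Unset Printing Implicit Defensive.

Import GRing.Theory.

(** * Stirling numbers of the first kind *)

Lemma porbit_lift_perm_fixed (n : nat) (i : 'I_n.+1) (s : 'S_n) :
  porbit (lift_perm i i s) i = [set i].
Proof.
apply/eqP; rewrite eqEsubset sub1set porbit_id andbT.
apply/subsetP=> _ /porbitP[k ->]; rewrite inE.
by elim: k => [|k IH]; rewrite ?expg0 ?perm1 // expgSr permM (eqP IH) lift_perm_id.
Qed.

Lemma porbit_lift_perm (n : nat) (i : 'I_n.+1) (s : 'S_n) (k : 'I_n) :
  porbit (lift_perm i i s) (lift i k) = lift i @: porbit s k.
Proof.
have E l : (lift_perm i i s ^+ l)%g (lift i k) = lift i ((s ^+ l)%g k).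
  elim: l => [|l IH]; first by rewrite !expg0 !perm1.
  by rewrite !expgSr !permM IH lift_perm_lift.
apply/setP=> x; apply/porbitP/imsetP => [[l ->]|[y /porbitP[l ->] ->]].
  by exists ((s ^+ l)%g k); rewrite ?E ?mem_porbit.
by exists l; rewrite E.
Qed.

(** The cycles of [lift_perm i i s] are the fixed point [i] and the images under [lift i] of the
    cycles of [s]. *)
Lemma card_porbits_lift_perm (n : nat) (i : 'I_n.+1) (s : 'S_n) :
  #|porbits (lift_perm i i s)| = #|porbits s|.+1.
Proof.
have -> : porbits (lift_perm i i s) =
    [set i] |: [set lift i @: (A : {set 'I_n}) | A in porbits s].
  apply/setP=> A; rewrite !inE; apply/imsetP/orP => [[x _ ->]|[/eqP->|]].
  - case: (unliftP i x) => [k ->|->]; last by left; rewrite porbit_lift_perm_fixed.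
    by right; rewrite porbit_lift_perm; apply: imset_f; apply: imset_f.
  - by exists i; rewrite ?porbit_lift_perm_fixed.
  - case/imsetP=> _ /imsetP[k _ ->] ->.
    by exists (lift i k); rewrite ?porbit_lift_perm.
rewrite cardsU1 card_imset; last exact/imset_inj/lift_inj.
have -> // : [set i] \notin [set lift i @: (A : {set 'I_n}) | A in porbits s].
apply/imsetP=> -[A _ /setP/(_ i)]; rewrite inE eqxx => /esym/imsetP[k _ ik].
by move: (neq_lift i k); rewrite -ik eqxx.
Qed.

Lemma card_porbits_tperm_lift_perm (n : nat) (i : 'I_n.+1) (s : 'S_n) :
  #|porbits (tperm ord0 i * lift_perm ord0 ord0 s)| = #|porbits s| + (i == ord0).
Proof.
have := porbits_mul_tperm (lift_perm ord0 ord0 s) i ord0 => /=.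
rewrite porbit_lift_perm_fixed inE card_porbits_lift_perm tpermC.
case: eqP => _ /=; lia.
Qed.

Lemma stirling1E (N : nat) (r : int) :
  stirling1 N r = \sum_(s : 'S_N) (Posz #|porbits s| == r).
Proof. by rewrite /stirling1 -sum1dep_card big_mkcond. Qed.

(* Every permutation of [N.+1] points is uniquely [tperm ord0 i * t] with [t]
   fixing [ord0]; the transposition merges the cycle [(ord0)] of [t] into
   another one unless [i = ord0]. *)
Lemma stirling1S (N : nat) (r : int) :
  stirling1 N.+1 r = stirling1 N (r - 1)%R + N * stirling1 N r.
Proof.
pose h (p : 'I_N.+1 * 'S_N) : 'S_N.+1 :=
  (tperm ord0 p.1 * lift_perm ord0 ord0 p.2)%g.
have h_inj : injective h.
  move=> [i s] [j t]; rewrite /h /= => E.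
  (* Both products send the transposed point to [ord0], so it is recovered as the preimage of
     [ord0]. *)
  have ij : i = j.
    apply: (@perm_inj _ (tperm ord0 j * lift_perm ord0 ord0 t)%g).
    by rewrite -{1}E !permM !tpermR !lift_perm_id.
  move: E; rewrite ij => /mulgI /permP E; congr pair.
  by apply/permP=> k; move: (E (lift ord0 k)); rewrite !lift_perm_lift => /lift_inj.
have [g gK hK] : bijective h.
  by apply: inj_card_bij; rewrite // card_prod !card_Sn card_ord factS.
rewrite !stirling1E (reindex h) /=; last by exists g => p _.
rewrite -(pair_big xpredT xpredT (fun i s => Posz #|porbits (h (i, s))| == r : nat)) /=.
rewrite (bigD1 ord0) //=; congr (_ + _).
  by apply: eq_bigr => s _; rewrite card_porbits_tperm_lift_perm eqxx addn1 /=; congr nat_of_bool; apply/eqP/eqP; lia.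
rewrite (eq_bigr (fun=> \sum_(s : 'S_N) (Posz #|porbits s| == r))).
  rewrite sum_nat_const; congr (_ * _).
  by rewrite (eq_card (_ : _ =i predC1 ord0)) // cardC1 card_ord.
move=> i /negPf i0; apply: eq_bigr => s _.
by rewrite card_porbits_tperm_lift_perm i0 addn0.
Qed.

Lemma stirling1_0 (r : int) : stirling1 0 r = (r == 0%R).
Proof.
rewrite stirling1E (eq_bigr (fun=> (r == 0%R) : nat)) => [|s _].
  by rewrite sum_nat_const card_Sn mul1n.
suff -> : #|porbits s| = 0 by rewrite eq_sym.
by apply/eqP; rewrite cards_eq0; apply/eqP/setP => A; rewrite inE; apply/imsetP => -[[]].
Qed.

Lemma stirling1_gt (N : nat) (r : int) : (N%:Z < r)%R -> stirling1 N r = 0.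
Proof.
elim: N r => [|N IH] r Nr; first by rewrite stirling1_0; case: eqP => //; lia.
by rewrite stirling1S !IH ?muln0 //; lia.
Qed.

(** Multiplying by [1 + N *: 'X] reproduces the recurrence [stirling1S] at [r = N + 1 - x]; since
    [r] is an integer, [x > N] needs no separate case. *)
Lemma coef_prod_1DnatX (N x : nat) :
  ((\prod_(l < N) (1 + (l : nat) *: 'X : {poly nat}))`_x)%R = stirling1 N (N%:Z - x%:Z)%R.
Proof.
elim: N x => [|N IH] x.
  by rewrite big_ord0 stirling1_0 coef1; case: x.
rewrite big_ord_recr /= mulrDr mulr1 -scalerAr coefD coefZ coefMX stirling1S IH.
congr (_ + _); first by congr stirling1; lia.
case: x => [|x] /=; last by rewrite IH; congr (_ * stirling1 _ _); lia.
(* At [x = 0] the second term of the recurrence has [r = N + 1], hence vanishes. *)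
by rewrite stirling1_gt ?mulr0 ?muln0 //; lia.
Qed.

(** * Generating function of partial transversals *)

(* A partial transversal [S] of the fibres is encoded by the partial section
   [i |-> the element of S above i]. *)
Lemma card_partial_transversals (T I : finType) (f : T -> I) (q : nat) :
  #|[set S : {set T} | (#|S| == q) && `[< {in S &, injective f} >]]| =
  ((\prod_(i : I) (1 + #|f @^-1: [set i]| *: 'X : {poly nat}))`_q)%R.
Proof.
(* Weight of a choice above [i]: [None] skips the fibre, [Some t] contributes ['X] if [t] lies above
   [i] and kills the term otherwise. *)
pose w (i : I) (o : option T) : {poly nat} :=
  if o is Some t then ((f t == i)%:R *: 'X)%R else 1%R.
pose ok (g : {ffun I -> option T}) :=
  [forall i, if g i is Some t then f t == i else true].
pose graph (g : {ffun I -> option T}) := [set t | g (f t) == Some t].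
have -> : (\prod_(i : I) (1 + #|f @^-1: [set i]| *: 'X) =
           \prod_(i : I) \sum_(o : option T) w i o :> {poly nat})%R.
  apply: eq_bigr => i _; rewrite (bigD1 None) //=; congr (_ + _)%R.
  rewrite (reindex_omap Some id) => [|[]] //=.
  rewrite -scaler_suml -sum1_card; congr (_ *: _)%R.
  rewrite big_mkcond; under [RHS]eq_bigl do rewrite eqxx.
  by apply: eq_bigr => t _; rewrite !inE; case: (f t == i).
rewrite bigA_distr_bigA coef_sum.
have term (g : {ffun I -> option T}) : ((\prod_i w i (g i))`_q)%R = ok g && (#|[set i | g i]| == q) :> nat.
  have [/forallP okg|/forallPn[i]] /= := boolP (ok g); last first.
    rewrite (bigD1 i) //=; case: (g i) => // t /negPf /= ->.
    by rewrite scale0r mul0r coef0.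
  rewrite (eq_bigr (fun i => if i \in [set i | g i] then 'X else 1)%R) => [|i _].
    by rewrite -big_mkcond prodr_const coefXn eq_sym; case: (_ == _).
  by rewrite inE; move: (okg i); case: (g i) => //= t ->; rewrite scale1r.
rewrite (eq_bigr _ (fun g _ => term g)) -big_mkcond sum1dep_card.
have graph_inj g : {in graph g &, injective f}.
  by move=> t u; rewrite !inE => /eqP + /eqP + E; rewrite E => -> [].
have in_graph g i t : ok g -> (g i = Some t) <-> (t \in graph g /\ f t = i).
  move=> /forallP okg; rewrite inE; split => [E|[/eqP E <-//]].
  by move: (okg i); rewrite E => /eqP ->; rewrite E eqxx.
rewrite -(card_in_imset (f := graph)) => [|g h]; last first.
  rewrite !inE => /andP[okg _] /andP[okh _] E; apply/ffunP=> i.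
  case gi: (g i) => [t|]; first by apply/esym/in_graph; rewrite -?E //; apply/in_graph.
  case hi: (h i) => [t|//].
  by move: hi => /(in_graph _ _ _ okh); rewrite -E => /(in_graph _ _ _ okg); rewrite gi.
congr #|pred_of_set _|; apply/setP=> S; rewrite inE.
apply/andP/imsetP => [[/eqP Sq /asboolP S_inj]|[g]]; last first.
  rewrite inE => /andP[okg /eqP gq] ->; split; last exact/asboolP/graph_inj.
  rewrite -(card_in_imset (@graph_inj g)) -gq; apply/eqP/eq_card => i; rewrite inE.
  apply/imsetP/idP => [[t tg ->]|]; first by move: tg; rewrite inE => /eqP ->.
  by case gi: (g i) => [t|//] _; exists t; case/(in_graph _ _ _ okg): gi.
(* Since [f] is injective on [S], at most one element of [S] lies above [i], and [pick] finds it. *)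
pose g := [ffun i => [pick t in S | f t == i]].
have okg : ok g.
  by apply/forallP=> i; rewrite ffunE; case: pickP => // t /andP[].
have gS : S = graph g.
  apply/setP=> t; rewrite inE ffunE; case: pickP => [u /andP[uS /eqP fu]|/(_ t)].
    apply/idP/eqP => [tS|[<-]//]; congr Some; exact: S_inj.
  by rewrite eqxx andbT => ->.
exists g => //; rewrite inE okg -Sq gS -(card_in_imset (@graph_inj g)) /=.
apply/eqP/eq_card => i; rewrite inE.
apply/idP/imsetP => [|[t tg ->]]; last by move: tg; rewrite inE => /eqP ->.
by case gi: (g i) => [t|//] _; exists t; case/(in_graph _ _ _ okg): gi.
Qed.

(** * Coefficients of products, up to degree [q] *)

Lemma coef_1DnatX_exp (a A j : nat) :
  (((1 + a *: 'X : {poly nat}) ^+ A)`_j)%R = 'C(A, j) * a ^ j.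
Proof.
rewrite exprDn coef_sum.
have E (i : 'I_A.+1) : ((1 ^+ (A - i) * (a *: 'X : {poly nat}) ^+ i *+ 'C(A, i))`_j)%R
    = if i == j :> nat then 'C(A, j) * a ^ j else 0.
  rewrite expr1n mul1r exprZn coefMn coefZ coefXn eq_sym.
  case: eqP => [->|_]; last by rewrite mulr0 mul0rn.
  by rewrite mulr1 -mulr_natr natrXE natn mulrC.
rewrite (eq_bigr _ (fun i _ => E i)); have [jA|jA] := ltnP j A.+1.
  rewrite (bigD1 (Ordinal jA)) //= eqxx big1 ?addr0 // => i /eqP ij.
  by by case: eqP => // E'; case: ij; exact: val_inj.
rewrite bin_small // mul0n big1 // => i _; case: eqP => // ij; have := ltn_ord i; lia.
Qed.

(** Congruence modulo ['X^q.+1]; it allows each factor to be cut off at degree [q], which gives the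
    ranges ['I_q.+1] of the final sum. *)
Definition coefs_eq_upto (q : nat) (p r : {poly nat}) :=
  forall i, i <= q -> (p`_i = r`_i)%R.

Lemma coefs_eq_uptoM (q : nat) (p p' r r' : {poly nat}) :
  coefs_eq_upto q p p' -> coefs_eq_upto q r r' ->
  coefs_eq_upto q (p * r)%R (p' * r')%R.
Proof.
move=> pp rr i iq; rewrite !coefM; apply: eq_bigr => k _.
by rewrite pp ?rr // ?(leq_trans (leq_subr _ _)) // (leq_trans _ iq) // -ltnS.
Qed.

Lemma coefs_eq_upto_prod (q : nat) (I : finType) (p r : I -> {poly nat}) :
  (forall i, coefs_eq_upto q (p i) (r i)) ->
  coefs_eq_upto q (\prod_i p i)%R (\prod_i r i)%R.
Proof.
move=> pr; elim/big_rec2: _ => // i y1 y2 _ IH.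
exact: coefs_eq_uptoM.
Qed.

Definition truncation (q : nat) (a : nat -> nat) : {poly nat} :=
  (\sum_(x < q.+1) a x *: 'X^x)%R.

Lemma coefs_eq_upto_truncation (q : nat) (a : nat -> nat) (p : {poly nat}) :
  (forall x, (p`_x)%R = a x) -> coefs_eq_upto q p (truncation q a).
Proof.
move=> pa i iq; rewrite pa /truncation -(poly_def q.+1 a) coef_poly ltnS iq //.
Qed.

Lemma coef_mul_truncations (q : nat) (I : finType) (A B H : nat -> nat) :
  ((truncation q B * (truncation q A * \prod_(i : I) truncation q H))`_q)%R =
  \sum_(k < q.+1) \sum_(j < q.+1)
    \sum_(x : {ffun I -> 'I_q.+1} | k + j + \sum_(i : I) x i == q)
      A j * B k * \prod_(i : I) H (x i).
Proof.
rewrite /truncation bigA_distr_bigA /= mulr_suml coef_sum; apply: eq_bigr => k _.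
rewrite mulr_suml mulr_sumr coef_sum; apply: eq_bigr => j _.
rewrite !mulr_sumr coef_sum [RHS]big_mkcond; apply: eq_bigr => x _.
rewrite scaler_prod -(big_morph _ (@exprD _ _) (expr0 _)).
rewrite -!(scalerAl, scalerAr) -!exprD !coefZ coefXn addnA eq_sym.
case: eqP => _; rewrite ?mulr0 // mulr1.
by rewrite mulrA (mulrC (B k)).
Qed.

(** * Lines of direction [(c, d)] and their first points *)

(* The case split is needed because [i %/ 0 = 0]. *)
Definition line_index (c d i j : nat) : nat :=
  if c == 0 then j %/ d else minn (i %/ c) (j %/ d).

(** Coordinates are zero-based: one step back by [(c, d)] would make one of them negative. *)
Definition is_line_start (c d i j : nat) : bool := ~~ ((c <= i) && (d <= j)).

(** After [line_index] steps back, the coordinate attaining the minimum is a remainder modulo [c] or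
    [d], so no further step is possible. *)
Lemma line_index_spec (c d i j : nat) : 0 < d ->
  let k := line_index c d i j in
  [/\ k * c <= i, k * d <= j & is_line_start c d (i - k * c) (j - k * d)].
Proof.
rewrite /line_index /is_line_start => d0; have := divn_eq j d.
have := ltn_pmod j d0; have [->|c0] /= := eqVneq c 0.
  by move=> lt E; split; rewrite ?muln0 ?leq_divM //; lia.
rewrite -lt0n in c0; have := divn_eq i c; have := ltn_pmod i c0.
set a := i %/ c; set b := j %/ d => lti Ei ltj Ej.
have [ab|ba] := leqP a b; split; first [by rewrite ?leq_divM | nia].
Qed.

(** A nonzero displacement would put one of the two points at least one full step [(c, d)] inside
    the quadrant. *)
Lemma line_start_unique (c d a b a' b' : nat) (e : int) : 0 < d ->
  is_line_start c d a b -> is_line_start c d a' b' ->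
  (a'%:Z = a%:Z + e * c%:Z)%R -> (b'%:Z = b%:Z + e * d%:Z)%R -> e = 0%R.
Proof.
rewrite /is_line_start => d0 st st' Ea Eb.
have [//|[e0|e0]] : (e = 0 \/ e < 0 \/ 0 < e)%R by lia.
  by move/negP: st; case; apply/andP; split; nia.
by move/negP: st'; case; apply/andP; split; nia.
Qed.

Lemma ord_sub_subproof (m : nat) (i : 'I_m) (k : nat) : i - k < m.
Proof. exact: leq_ltn_trans (leq_subr _ _) (ltn_ord i). Qed.

(** A line is represented by its first point, so lines are fibres of a self-map of the board; a
    point that starts no line has an empty fibre. *)
Definition line_start (c d m n : nat) (s : 'I_m * 'I_n) : 'I_m * 'I_n :=
  let k := line_index c d s.1 s.2 in
  (Ordinal (ord_sub_subproof s.1 (k * c)), Ordinal (ord_sub_subproof s.2 (k * d))).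

Lemma line_startP (c d m n : nat) (s p : 'I_m * 'I_n) (k : nat) : 0 < d ->
  is_line_start c d p.1 p.2 ->
  s.1 = p.1 + k * c :> nat -> s.2 = p.2 + k * d :> nat ->
  line_start c d s = p /\ line_index c d s.1 s.2 = k.
Proof.
move=> d0 stp E1 E2; have [k1 k2 st] := line_index_spec c s.1 s.2 d0.
have e0 := @line_start_unique c d p.1 p.2 _ _
  (k%:Z - (line_index c d s.1 s.2)%:Z)%R d0 stp st.
have ek : line_index c d s.1 s.2 = k.
  move: e0; set l := line_index _ _ _ _ in k1 k2 st * => e0.
  by have := e0 ltac:(nia) ltac:(nia); lia.
split=> //; case: p stp E1 E2 {e0} => p1 p2 /= stp E1 E2.
by congr pair; apply: val_inj; rewrite /= ek ?E1 ?E2 addnK.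
Qed.

Lemma line_start_decomp (c d m n : nat) (s : 'I_m * 'I_n) : 0 < d ->
  let p := line_start c d s in let k := line_index c d s.1 s.2 in
  [/\ is_line_start c d p.1 p.2, s.1 = p.1 + k * c :> nat
    & s.2 = p.2 + k * d :> nat].
Proof.
by move=> d0; have [k1 k2 st] := line_index_spec c s.1 s.2 d0; split=> //=; rewrite subnK.
Qed.

Lemma eq_line_start (c d m n : nat) (s t : 'I_m * 'I_n) : 0 < d ->
  line_start c d s = line_start c d t <->
  exists k : int, square t = ((square s).1 + k * c%:Z, (square s).2 + k * d%:Z)%R.
Proof.
move=> d0; have [sts s1 s2] := line_start_decomp c s d0.
have [stt t1 t2] := line_start_decomp c t d0.
set p := line_start c d s in sts s1 s2 *; set p' := line_start c d t in stt t1 t2 *.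
set k := line_index _ _ _ _ in s1 s2; set k' := line_index _ _ _ _ in t1 t2.
split=> [pp|[e [E1 E2]]].
  exists (k'%:Z - k%:Z)%R; rewrite /square /= s1 s2 t1 t2 pp; congr pair; lia.
(* From [p' + k' (c, d) = p + (k + e) (c, d)], the starts differ by [e + k - k'] steps. *)
have /eqP := @line_start_unique c d p.1 p.2 p'.1 p'.2 (e + k%:Z - k'%:Z)%R d0 sts stt
  ltac:(lia) ltac:(lia).
rewrite subr_eq0 => /eqP E.
rewrite [p]surjective_pairing [p']surjective_pairing.
by congr pair; apply: val_inj => /=; nia.
Qed.

Lemma nonattackingP (c d m n : nat) (S : {set 'I_m * 'I_n}) : 0 < d ->
  nonattacking (Posz c, Posz d) S <-> {in S &, injective (@line_start c d m n)}.
Proof.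
move=> d0; split=> [na s t sS tS /(eq_line_start _ _ _ d0)[k E]|inj s t sS tS st [k [_ E]]].
  have [//|/eqP st] := eqVneq s t.
  (* An attack requires [k <> 0]; here [k = 0] would give [s = t]. *)
  case: (na s t sS tS st); exists k; split=> // k0; apply: st.
  move: E; rewrite k0 !mul0r !addr0; case: s t {sS tS} => [s1 s2] [t1 t2] [E1 E2].
  by congr pair; apply: val_inj.
by apply/st/inj => //; apply/eq_line_start => //; exists k.
Qed.

(** The fibre of a line start consists of the points [p + k (c, d)] on the board, and these [k] form
    an initial segment of the naturals. *)
Lemma card_line_gt (c d m n l : nat) (p : 'I_m * 'I_n) : 0 < d ->
  (l < #|@line_start c d m n @^-1: [set p]|) =
  [&& is_line_start c d p.1 p.2, p.1 + l * c < m & p.2 + l * d < n].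
Proof.
move=> d0; apply/idP/and3P => [lt|[stp lm ln]]; last first.
  have hm (k : 'I_l.+1) : p.1 + k * c < m.
    by apply: leq_ltn_trans lm; rewrite leq_add2l leq_mul2r -ltnS ltn_ord orbT.
  have hn (k : 'I_l.+1) : p.2 + k * d < n.
    by apply: leq_ltn_trans ln; rewrite leq_add2l leq_mul2r -ltnS ltn_ord orbT.
  pose h k := (Ordinal (hm k), Ordinal (hn k)).
  have hP k := @line_startP c d m n (h k) p k d0 stp erefl erefl.
  have h_inj : injective h.
    by move=> k k' E; apply: val_inj; rewrite /= -(hP k).2 E (hP k').2.
  rewrite -[l.+1]card_ord -(card_codom h_inj); apply/subset_leq_card/subsetP.
  by move=> _ /codomP[k ->]; rewrite !inE (hP k).1.
have [s sp] : exists s, s \in @line_start c d m n @^-1: [set p].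
  by apply/card_gt0P; apply: leq_ltn_trans lt.
have stp : is_line_start c d p.1 p.2.
  by move: sp; rewrite !inE => /eqP <-; case: (line_start_decomp c s d0).
suff [t /[!inE] /eqP tp lk] : exists2 t, t \in @line_start c d m n @^-1: [set p]
    & l <= line_index c d t.1 t.2.
  have [_ t1 t2] := line_start_decomp c t d0; rewrite tp in t1 t2.
  split=> //.
    by apply: leq_ltn_trans (ltn_ord t.1); rewrite t1 leq_add2l leq_mul2r lk orbT.
  by apply: leq_ltn_trans (ltn_ord t.2); rewrite t2 leq_add2l leq_mul2r lk orbT.
(* Otherwise every index on the line is below [l]; points of one line are determined by their index,
   so there are at most [l] of them. *)
apply: contraPP lt => nex; apply/negP; rewrite -leqNgt.
rewrite cardE -(size_map (fun s : 'I_m * 'I_n => line_index c d s.1 s.2)) -[leqRHS](size_iota 0).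
apply: uniq_leq_size.
  rewrite map_inj_in_uniq ?enum_uniq // => t u; rewrite !mem_enum !inE.
  move=> /eqP tp /eqP up E.
  have [_ t1 t2] := line_start_decomp c t d0.
  have [_ u1 u2] := line_start_decomp c u d0.
  rewrite tp E in t1 t2; rewrite up in u1 u2.
  rewrite [t]surjective_pairing [u]surjective_pairing.
  by congr pair; apply: val_inj; [exact: etrans t1 (esym u1) | exact: etrans t2 (esym u2)].
move=> _ /mapP[t /[!mem_enum] tp ->]; rewrite mem_iota /= add0n ltnNge.
by apply/negP=> lk; apply: nex; exists t.
Qed.

(** * Counting lines by length *)

Lemma card_ord_between (m a x : nat) :
  #|[set i : 'I_m | (a <= i) && (i + x < m)]| = m - x - a.
Proof.
have h (i : 'I_(m - x - a)) : a + i < m by have := ltn_ord i; lia.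
rewrite -[RHS]card_ord -(card_codom (f := fun i => Ordinal (h i))); last first.
  by move=> i j [/addnI] /val_inj.
apply: eq_card => i; rewrite inE; apply/andP/codomP => [[ai im]|[j ->] /=].
  by have ia : i - a < m - x - a by [lia]; exists (Ordinal ia); apply: val_inj => /=; lia.
by have := ltn_ord j; lia.
Qed.

Lemma card_rect (m n a b x y : nat) :
  #|[set p : 'I_m * 'I_n | [&& a <= p.1, p.1 + x < m, b <= p.2 & p.2 + y < n]]| =
  (m - x - a) * (n - y - b).
Proof.
rewrite -!card_ord_between -cardsX; apply: eq_card => p; by rewrite !inE -andbA.
Qed.

(* A line has more than [l] points iff its first point [p] satisfies
   [p + l (c, d)] in the board; first points are those outside the corner
   rectangle [p.1 >= c], [p.2 >= d]. *)
Lemma count_lines_gt (c d m n l : nat) : 0 < d ->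
  #|[set p | l < #|@line_start c d m n @^-1: [set p]|]| +
    (m - l * c - c) * (n - l * d - d) = (m - l * c) * (n - l * d).
Proof.
move=> d0; have := card_rect m n 0 0 (l * c) (l * d); rewrite !subn0 => <-.
rewrite -card_rect addnC.
rewrite -(cardsID [set p : 'I_m * 'I_n | (c <= p.1) && (d <= p.2)]
                  [set p : 'I_m * 'I_n | [&& 0 <= p.1, _, 0 <= p.2 & _]]).
congr (_ + _); apply: eq_card => p; rewrite !inE ?card_line_gt // /is_line_start.
by rewrite !leq0n; do 4?case: (leq _ _).
Qed.

Lemma count_lines_eq (c d m n l : nat) :
  #|[set p | l < #|@line_start c d m n @^-1: [set p]|]| =
  #|[set p | #|@line_start c d m n @^-1: [set p]| == l.+1]| +
  #|[set p | l.+1 < #|@line_start c d m n @^-1: [set p]|]|.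
Proof.
rewrite -(cardsID [set p | #|@line_start c d m n @^-1: [set p]| == l.+1]).
by congr (_ + _); apply: eq_card => p; rewrite !inE; lia.
Qed.

Lemma rider_countE (c d q m n : nat) : 0 < d ->
  rider_count (Posz c, Posz d) q m n =
  ((\prod_(p : 'I_m * 'I_n)
     (1 + #|@line_start c d m n @^-1: [set p]| *: 'X : {poly nat}))`_q)%R.
Proof.
move=> d0; rewrite -card_partial_transversals; apply: eq_card => S; rewrite !inE.
by congr (_ && _); apply/asboolP/asboolP => /(nonattackingP c S d0).
Qed.

Section LineLengthCounts.

Variables m n c d : nat.
Hypotheses (d_gt0 : 0 < d) (le_divn : 0 < c -> n %/ d <= m %/ c).

Let len (p : 'I_m * 'I_n) := #|@line_start c d m n @^-1: [set p]|.
Let N := n %/ d.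

(** Together with [leq_mul_d], this keeps the truncated subtractions exact for [l <= N]. *)
Let leq_mul_c (l : nat) : l <= N -> l * c <= m.
Proof.
case: (posnP c) => [->|c0 lN]; first by rewrite muln0.
exact: leq_trans (leq_mul (leq_trans lN (le_divn c0)) (leqnn c)) (leq_divM _ _).
Qed.

Let leq_mul_d (l : nat) : l <= N -> l * d <= n.
Proof. by move=> lN; apply: leq_trans (leq_mul lN (leqnn d)) (leq_divM _ _). Qed.

Let n_lt : n < N.+1 * d.
Proof. exact: ltn_ceil. Qed.

Let count_gt (l : nat) :
  #|[set p | l < len p]| + (m - l * c - c) * (n - l * d - d) =
  (m - l * c) * (n - l * d).
Proof. exact: count_lines_gt. Qed.

Let count_eq (l : nat) :
  #|[set p | l < len p]| = #|[set p | len p == l.+1]| + #|[set p | l.+1 < len p]|.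
Proof. exact: count_lines_eq. Qed.

Lemma line_length_leq (p : 'I_m * 'I_n) : len p <= N.+1.
Proof.
rewrite leqNgt card_line_gt //; apply/negP=> /and3P[_ _].
by have := n_lt; lia.
Qed.

Lemma count_lines_short (l : nat) : l.+1 < N ->
  #|[set p | len p == l.+1]| = 2 * c * d.
Proof.
move=> lN; have mc := leq_mul_c lN; have nd := leq_mul_d lN.
have := count_gt l; have := count_gt l.+1; have := count_eq l.
(* As [l + 2 <= N], no subtraction truncates, and the second difference is [(u + 2c)(v + 2d) - 2(u +
   c)(v + d) + uv = 2cd]. *)
have [u Em] : exists u, m = c + (c + l * c) + u by exists (m - l.+2 * c); lia.
have [v En] : exists v, n = d + (d + l * d) + v by exists (n - l.+2 * d); lia.
rewrite !mulSn.
have -> : m - l * c = u + 2 * c by lia.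
have -> : n - l * d = v + 2 * d by lia.
have -> : m - (c + l * c) = u + c by lia.
have -> : n - (d + l * d) = v + d by lia.
have -> : u + 2 * c - c = u + c by lia.
have -> : v + 2 * d - d = v + d by lia.
rewrite !addnK; lia.
Qed.

Lemma count_lines_longest : #|[set p | len p == N.+1]| = (n %% d) * (m - c * N).
Proof.
have := count_gt N; have := count_eq N.
rewrite (_ : #|[set p | N.+1 < _]| = 0); last first.
  by apply/eqP; rewrite cards_eq0; apply/eqP/setP=> p; rewrite !inE ltnNge line_length_leq.
(* The corner rectangle is empty because [n < (N + 1) d]. *)
have -> : n - N * d - d = 0 by have := n_lt; lia.
have -> : n - N * d = n %% d by rewrite {1}(divn_eq n d) addKn.
by rewrite muln0 !addn0 => -> ->; rewrite mulnC (mulnC c).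
Qed.

(** With [M = m - c N] and [r = n %% d], the second difference loses its last term and becomes
    [(M + c)(r + d) - 2 M r]. *)
Lemma count_lines_long : 0 < N ->
  #|[set p | len p == N]| = (d - n %% d) * (m - c * N) + c * (n %% d + d).
Proof.
move=> N0; have := count_lines_longest; have mc := leq_mul_c (leqnn N).
have nd := divn_eq n d; have := ltn_pmod n d_gt0; rewrite -/N in nd *.
have := count_eq N.-1; have := count_gt N.-1; have := count_gt N.
rewrite prednK //.
have -> : m - N.-1 * c = m - c * N + c by case: (N) N0 mc => // k _; lia.
have -> : n - N.-1 * d = n %% d + d by case: (N) N0 nd => // k _; lia.
have -> : n - N * d = n %% d by lia.
rewrite (mulnC N c) !addnK.
have -> : n %% d - d = 0 by lia.
nia.
Qed.

Lemma prod_line_lengths : 0 < N ->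
  (\prod_p (1 + len p *: 'X : {poly nat}) =
   (1 + N.+1 *: 'X) ^+ ((n %% d) * (m - c * N)) *
   ((1 + N *: 'X) ^+ ((d - n %% d) * (m - c * N) + c * (n %% d + d)) *
    \prod_(i < 2 * c * d) \prod_(l < N) (1 + (l : nat) *: 'X)))%R.
Proof.
(* Factors are grouped by length; [inord] is faithful since lengths are at most [N + 1]. *)
move=> N0; rewrite (partition_big (fun p => inord (len p) : 'I_N.+2) xpredT) //=.
have E (l : 'I_N.+2) :
    (\prod_(p | inord (len p) == l) (1 + len p *: 'X : {poly nat}) =
     (1 + (l : nat) *: 'X) ^+ #|[set p | len p == l]|)%R.
  rewrite -prodr_const; apply: eq_big => p; last first.
    by move=> /eqP <-; rewrite inordK // ltnS line_length_leq.
  by rewrite inE -val_eqE /= inordK // ltnS line_length_leq.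
rewrite (eq_bigr _ (fun l _ => E l)) !big_ord_recr /=.
rewrite count_lines_longest count_lines_long // mulrC; congr (_ * _)%R.
rewrite mulrC; congr (_ * _)%R; rewrite prodr_const card_ord -prodrXl.
(* For length 0 the factor is 1, whatever the exponent. *)
apply: eq_bigr => -[[|l] lN] _ /=; first by rewrite scale0r addr0 !expr1n.
by rewrite count_lines_short.
Qed.

End LineLengthCounts.

(** * The coefficient of ['X^q] in the product over lines *)

Theorem theorem3p3 (m n c d q : nat)
    (hm : 0 < m) (hn : 0 < n) (hd : 0 < d) (hcd : coprime c d)
    (hN : 0 < n %/ d) (hNm : 0 < c -> n %/ d <= m %/ c) (hq : 0 < q) :
  rider_count (Posz c, Posz d) q m n =
  \sum_(k < q.+1) \sum_(j < q.+1)
    \sum_(x : {ffun 'I_(2 * c * d) -> 'I_q.+1}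
          | k + j + \sum_(i < 2 * c * d) x i == q)
      'C((d - n %% d) * (m - c * (n %/ d)) + c * (n %% d + d), j)
      * (n %/ d) ^ j
      * 'C((n %% d) * (m - c * (n %/ d)), k)
      * (n %/ d).+1 ^ k
      * \prod_(i < 2 * c * d)
          stirling1 (n %/ d) (Posz (n %/ d) - Posz (x i))%R.
Proof.
rewrite rider_countE // prod_line_lengths //.
set N := n %/ d; set A := _ + c * _; set B := _ %% d * _.
have := coef_mul_truncations q 'I_(2 * c * d) (fun j => 'C(A, j) * N ^ j)
  (fun k => 'C(B, k) * N.+1 ^ k) (fun x => stirling1 N (N%:Z - x%:Z)%R).
under [X in _ = X -> _]eq_bigr => k _.
  under eq_bigr => j _ do under eq_bigr => x _ do rewrite !mulnA.
  over.
(* Each factor agrees with its truncation up to degree [q], hence so do the products. *)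
move=> <-; apply: (@coefs_eq_uptoM q) => //.
  by apply: coefs_eq_upto_truncation => k; apply: coef_1DnatX_exp.
apply: coefs_eq_uptoM.
  by apply: coefs_eq_upto_truncation => j; apply: coef_1DnatX_exp.
apply: coefs_eq_upto_prod => i.
by apply: coefs_eq_upto_truncation => x; apply: coef_prod_1DnatX.
Qed.
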